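(* Assume that $\mathsf{PRG}$ is a secure pseudorandom generator and that $\mathsf{Predictor}$ does not always output distributions of zero entropy. The single-bit watermarking scheme $\mathcal{W}=(\mathsf{KeyGen},\mathsf{Embed},\mathsf{Detect})$ described in the context is correct; that is, for all bit strings $b$ of length $|b|<\mathsf{poly}(\lambda)$, $$\mathbf{Pr}\left[\mathsf{Detect}_{sk}(b)\neq m \mid b=\mathsf{Embed}_{sk}(z,m),\ m\in\{0,1\}\right]<\mathsf{negl}(\lambda)$$ and $$\mathbf{Pr}\left[\mathsf{Detect}_{sk}(b)\neq\bot \mid b \text{ sampled from } \mathsf{Unif}\{0,1\}^{\mathsf{poly}(\lambda)}\right]<\mathsf{negl}(\lambda),$$ where $\mathsf{Detect}_{sk}(b)$ stands for the signal component of the detector's output.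
   Context: Notation: $\lambda$ is the security parameter; $\mathsf{poly}$ denotes a polynomially bounded function; $\mathsf{negl}$ denotes a negligible function (asymptotically smaller than the inverse of any polynomial). A fixed negligible function $\eta(\lambda)\in(0,1)$ is used as threshold in the algorithms below. Model: $\mathsf{Predictor}$ is a deterministic algorithm mapping any $z\in\{0,1\}^*$ to a distribution $(p(0),p(1))$ of the next bit. $\mathsf{PRG}$ is a pseudorandom generator: its output on a random key is indistinguishable from uniform bits of polynomial length by polynomial-time adversaries, up to negligible advantage; its output is converted to a sequence of real numbers $r_1,r_2,\dots\in[0,1]$ (a block of random bits $rb_1,rb_2,\dots$ being read as $\sum_i rb_i2^{-i}$). Scheme $\mathcal{W}$: - $\mathsf{KeyGen}(1^\lambda)$ outputs a random secret key $sk$. - $\mathsf{Wat\text{-}Sampler}((p(0),p(1)),m,r)$: if $m=0$, output $0$ when $r\le p(0)$ and $1$ otherwise; if $m=1$, output $1$ when $r\le p(1)$ and $0$ otherwise. - $\mathsf{Detect\text{-}1bit}(b,r)=\mathds{1}(r<1/2)\oplus b$. - $\mathsf{Embed}_{sk}(z,m)$, for a prompt $z\in\{0,1\}^*$ and signal $m\in\{0,1\}$: for $i=1,2,\dots$, let $(p(0),p(1))=\mathsf{Predictor}(z)$, let $r_i$ be the $i$-th number from $\mathsf{PRG}(sk)$, let $b_i=\mathsf{Wat\text{-}Sampler}((p(0),p(1)),m,r_i)$, append $b_i$ to $z$, let $X_i=\mathsf{Detect\text{-}1bit}(b_i,r_i)$ and $X=\frac1i\sum_{n=1}^iX_n$;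 stop as soon as $\exp(-2i(X-1/2)^2)<\eta(\lambda)$ and output $b=b_1b_2\cdots b_i$. - $\mathsf{Detect}_{sk}(b)$: for $i=1,\dots,|b|$, let $r_i$ be the $i$-th number from $\mathsf{PRG}(sk)$, $X_i=\mathsf{Detect\text{-}1bit}(b_i,r_i)$, $X=\frac1i\sum_{n=1}^iX_n$; at the first $i$ with $\exp(-2i(X-1/2)^2)<\eta(\lambda)$, stop and output signal $0$ if $X>1/2$ and signal $1$ if $X<1/2$, together with the substring $b_{1:i}$. If no such $i$ exists, output $\bot$ and the empty string.
   Formalization: Predictor is assumed polynomial-time; the prompt z is fixed or generated in polynomial time from λ; the first probability is that of the joint event that Embed outputs some b with |b|<poly(λ) and Detect errs, not normalized by the chance of stopping. *)

(* Defs.v *)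
From HB Require Import structures.
From mathcomp Require Import all_boot all_order all_algebra.
From mathcomp Require Import boolp reals sequences exp.

Set Implicit Arguments.
Unset Strict Implicit.
Unset Printing Implicit Defensive.

Import Order.TTheory GRing.Theory Num.Theory.
Local Open Scope ring_scope.

Notation bits := (seq bool).

Definition poly_bounded (f : nat -> nat) : Prop :=
  exists d, forall n, (f n <= n ^ d + d)%N.

Definition negl (R : realType) (f : nat -> R) : Prop :=
  forall c, exists N, forall n, (N <= n)%N -> `|f n| < n%:R ^- c.

(* Probability of E under the uniform distribution on T. *)
Definition Pr (R : realType) (T : finType) (E : T -> Prop) : R :=
  #|[set x : T | `[< E x >]]|%:R / #|T|%:R.

(* The machine model is a finite program over finitely many stacks of bits
   (stack x is s x for a store s).  Each primitive touches one stack top and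
   costs one step, so that the model is a multi-tape Turing machine with
   structured control, and defines the usual class of polynomial-time
   functions. *)

Inductive cmd : Type :=
| Push of bool & nat
| Pop of nat
| Seq of cmd & cmd
| Case of nat & cmd & cmd & cmd  (* branches: stack empty, top 0, top 1 *)
| While of nat & cmd.            (* iterate as long as the stack is nonempty *)

Definition store := nat -> bits.

Definition upd (s : store) (x : nat) (v : bits) : store :=
  fun y => if y == x then v else s y.

(* exec c s t s' : started in s, the program c halts in s' after t steps. *)
Inductive exec : cmd -> store -> nat -> store -> Prop :=
| exec_push b x s : exec (Push b x) s 1%N (upd s x (b :: s x))
| exec_pop x s : exec (Pop x) s 1%N (upd s x (behead (s x)))
| exec_seq c1 c2 s1 s2 s3 t1 t2 :
    exec c1 s1 t1 s2 -> exec c2 s2 t2 s3 -> exec (Seq c1 c2) s1 (t1 + t2)%N s3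
| exec_case x c0 c1 c2 s s' t :
    exec (match s x with
          | [::] => c0 | false :: _ => c1 | true :: _ => c2
          end) s t s' ->
    exec (Case x c0 c1 c2) s t.+1 s'
| exec_while_stop x c s : s x = [::] -> exec (While x c) s 1%N s
| exec_while_step x c s1 s2 s3 t1 t2 :
    s1 x <> [::] -> exec c s1 t1 s2 -> exec (While x c) s2 t2 s3 ->
    exec (While x c) s1 (t1 + t2).+1%N s3.

(* The map taking (the inputs encoded by) inp i to out i is computable in time
   polynomial in the total input length: the k-th input is placed on stack k,
   all other stacks are empty, and the output is read on stack 0. *)
Definition poly_time (I : Type) (inp : I -> seq bits) (out : I -> bits) : Prop :=
  exists (c : cmd) (d : nat), forall i : I, exists (t : nat) (s : store),
    [/\ exec c (nth [::] (inp i)) t s,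
        s 0%N = out i
      & (t <= sumn (map size (inp i)) ^ d + d)%N].

Definition unary (n : nat) : bits := nseq n true.

(* G sk is the output bit stream on the key sk; for security parameter lam the
   key is uniform in {0,1}^(kappa lam). *)

Definition generator := bits -> nat -> bool.

Definition prg_prefix (G : generator) (sk : bits) (n : nat) : bits :=
  mkseq (G sk) n.

(* Adversaries are probabilistic: A lam w u is the verdict on w with coins u. *)
Definition poly_time_adversary (A : nat -> bits -> bits -> bool) : Prop :=
  poly_time (fun '((lam, w, u) : nat * bits * bits) => [:: unary lam; w; u])
            (fun '((lam, w, u) : nat * bits * bits) => [:: A lam w u]).

Definition prg_advantage (R : realType) (kappa : nat -> nat) (G : generator)
    (n coins : nat -> nat) (A : nat -> bits -> bits -> bool) (lam : nat) : R :=
  `| Pr R (fun x : (kappa lam).-tuple bool * (coins lam).-tuple bool =>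
             A lam (prg_prefix G x.1 (n lam)) x.2)
   - Pr R (fun x : (n lam).-tuple bool * (coins lam).-tuple bool =>
             A lam x.1 x.2) |.

Definition secure_prg (R : realType) (kappa : nat -> nat) (G : generator) : Prop :=
  [/\ poly_bounded kappa,
      poly_time (fun '((sk, n) : bits * nat) => [:: sk; unary n])
                (fun '((sk, n) : bits * nat) => prg_prefix G sk n)
    & forall (n coins : nat -> nat) (A : nat -> bits -> bits -> bool),
        poly_bounded n -> poly_bounded coins -> poly_time_adversary A ->
        negl (prg_advantage R kappa G n coins A)].

(* The real number 0.s_1 s_2 ... in base 2. *)
Definition binary_fraction (R : realType) (s : bits) : R :=
  \sum_(j < size s) (nth false s j)%:R * 2 ^- j.+1.

Record bit_distr (R : realType) := BitDistr {
  prob :> bool -> R;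
  prob_ge0 : forall b, 0 <= prob b;
  prob_sum1 : prob false + prob true = 1 }.

Definition entropy (R : realType) (p : bit_distr R) : R :=
  - \sum_(b : bool) p b * (ln (p b) / ln 2).

Definition predictor_fun (R : realType) := bits -> bit_distr R.

(* Efficiency of a predictor with real-valued probabilities: p(b) is produced
   as a Dedekind cut, i.e. finite binary fractions r can be compared with it.
   This includes all predictors that write out p(0), p(1) as rationals. *)
Definition poly_time_predictor (R : realType) (P : predictor_fun R) : Prop :=
  poly_time
    (fun '((z, b, r) : bits * bool * bits) => [:: z; [:: b]; r])
    (fun '((z, b, r) : bits * bool * bits) => [:: binary_fraction R r <= P z b]).

Record scheme (R : realType) := Scheme {
  predictor : predictor_fun R;
  prg : generator;
  key_len : nat -> nat;     (* KeyGen(1^lam) is uniform on {0,1}^(key_len lam) *)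
  block_len : nat -> nat;   (* number of pseudorandom bits used for each r_i *)
  threshold : nat -> R (* eta(lam) *) }.

(* r_(i+1), as stream positions are counted from 0 *)
Definition prg_number (R : realType) (W : scheme R) (lam : nat) (sk : bits)
    (i : nat) : R :=
  binary_fraction R
    (mkseq (fun j => prg W sk (i * block_len W lam + j)%N) (block_len W lam)).

Definition wat_sampler (R : realType) (p : bit_distr R) (m : bool) (r : R) : bool :=
  if m then (if r <= p true then true else false)
  else (if r <= p false then false else true).

Definition detect_1bit (R : realType) (b : bool) (r : R) : bool :=
  (r < 1 / 2) (+) b.

(* X after i = |b| steps that produced the bits b *)
Definition mean_score (R : realType) (r : nat -> R) (b : bits) : R :=
  (\sum_(n < size b) (detect_1bit (nth false b n) (r n) : nat)%:R) / (size b)%:R.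

Definition stopped (R : realType) (e : R) (r : nat -> R) (b : bits) : bool :=
  expR (- 2 * (size b)%:R * (mean_score r b - 1 / 2) ^+ 2) < e.

(* The first [fuel] rounds of the loop of Embed, entered with the bits b already
   appended to the prompt z; None if the loop is still running. *)
Fixpoint embed_loop (R : realType) (P : predictor_fun R) (e : R) (r : nat -> R)
    (z : bits) (m : bool) (fuel : nat) (b : bits) : option bits :=
  if fuel is fuel'.+1 then
    let b' := rcons b (wat_sampler (P (z ++ b)) m (r (size b))) in
    if stopped e r b' then Some b' else embed_loop P e r z m fuel' b'
  else None.

(* b = Embed_sk(z, m).  A relation, because the loop need not terminate; the
   output is unique when it exists. *)
Definition embed (R : realType) (W : scheme R) (lam : nat) (sk z : bits)
    (m : bool) (b : bits) : Prop :=
  exists fuel, embed_loop (predictor W) (threshold W lam) (prg_number W lam sk)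
                 z m fuel [::] = Some b.

(* Signal (None for bottom) and substring.  At a stopping index X <> 1/2, since
   threshold < 1. *)
Definition detect (R : realType) (W : scheme R) (lam : nat) (sk b : bits) :
    option bool * bits :=
  let r := prg_number W lam sk in
  if [seq i <- iota 1 (size b) | stopped (threshold W lam) r (take i b)] is i :: _
  then (Some (mean_score r (take i b) < 1 / 2), take i b)
  else (None, [::]).

(* Main.v *)
Require Import Defs.
From HB Require Import structures.
From mathcomp Require Import all_boot all_order all_algebra.
From mathcomp Require Import boolp reals sequences exp.
From mathcomp Require Import zify ring lra.
Import Order.TTheory GRing.Theory Num.Theory.
Local Open Scope ring_scope.

(* In every round of Embed on truly random numbers, flipping the leading bit of
   the block read as r_i turns a score X_i on the wrong side into one on the
   right side, whatever the predictor answers.  So twice the number of wrong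
   scores minus the number of rounds has a moment generating function at most
   exp(2 t^2 n), and reaches the stopping deviation on the wrong side at round
   n with probability at most eta^(1/4), which is negligible.

   Detect follows the same rounds as Embed, so it fails only if Embed stops on
   the wrong side.  Were this likely for a pseudorandom stream, the adversary
   that simulates Embed and counts the wrong scores would break the generator.
   Only the stopping threshold may be hard to compute, and the adversary needs
   it for a single number of rounds per security parameter: the round is passed
   on by the length of the sample and the threshold by the number of coins.

   On uniform bits the scores are independent and uniform for each fixed key,
   so the second bound needs only the tail estimate. *)

(** * Programs over stacks of bits *)

Section Machine.
Local Open Scope nat_scope.

Definition runs (c : cmd) (s s' : store) (T : nat) : Prop :=
  exists2 t, exec c s t s' & t <= T.

Notation st l := (nth [::] l : store).

Lemma upd_nth l x v : upd (st l) x v = st (set_nth [::] l x v).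
Proof. by apply/funext => y; rewrite /upd nth_set_nth. Qed.

Lemma runs_weak {c s s' T T'} : runs c s s' T -> T <= T' -> runs c s s' T'.
Proof. by case=> t ? le ?; exists t => //; apply: leq_trans le _. Qed.

Lemma runs_push {b x} s : runs (Push b x) s (upd s x (b :: s x)) 1.
Proof. by exists 1 => //; constructor. Qed.

Lemma runs_pop {x} s : runs (Pop x) s (upd s x (behead (s x))) 1.
Proof. by exists 1 => //; constructor. Qed.

Lemma runs_seq {c1 c2 s1 s2 s3 T1 T2} :
  runs c1 s1 s2 T1 -> runs c2 s2 s3 T2 -> runs (Seq c1 c2) s1 s3 (T1 + T2).
Proof.
move=> [t1 e1 l1] [t2 e2 l2]; exists (t1 + t2); last exact: leq_add.
exact: exec_seq e1 e2.
Qed.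

Lemma runs_case {x c0 c1 c2 s s' T} :
  runs (match s x with [::] => c0 | false :: _ => c1 | true :: _ => c2 end)
    s s' T ->
  runs (Case x c0 c1 c2) s s' T.+1.
Proof. by case=> t e l; exists t.+1 => //; constructor. Qed.

Lemma runs_while {x c} (s : nat -> store) {n T} :
  (forall i, i < n -> s i x <> [::]) -> s n x = [::] ->
  (forall i, i < n -> runs c (s i) (s i.+1) T) ->
  runs (While x c) (s 0) (s n) (n * T.+1).+1.
Proof.
elim: n s => [|n IHn] s hne he hr; first by exists 1 => //; constructor.
have [t1 e1 l1] := hr 0 isT.
have [t2 e2 l2] : runs (While x c) (s 1) (s n.+1) (n * T.+1).+1.
  by apply: (IHn (fun i => s i.+1)) => // i lt; [apply: hne|apply: hr].
exists (t1 + t2).+1; last by rewrite mulSn; lia.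
exact: exec_while_step (hne 0 isT) e1 e2.
Qed.

Definition pour x y :=
  While x (Case x (Pop x) (Seq (Pop x) (Push false y)) (Seq (Pop x) (Push true y))).

Definition pour2 x y y' :=
  While x (Case x (Pop x)
    (Seq (Pop x) (Seq (Push false y) (Push false y')))
    (Seq (Pop x) (Seq (Push true y) (Push true y')))).

Ltac stacks := apply/funext => ?; rewrite /upd;
  repeat (case: eqP => //=; try (move=> ?; subst)); try by [].

Lemma runs_pour {x y} s : x <> y ->
  runs (pour x y) s (upd (upd s y (rev (s x) ++ s y)) x [::]) (size (s x) * 4).+1.
Proof.
move=> xy.
pose f i := upd (upd s y (rev (take i (s x)) ++ s y)) x (drop i (s x)).
have -> : s = f 0 by rewrite /f take0 drop0; stacks.
have -> : upd (upd (f 0) y (rev (f 0 x) ++ f 0 y)) x [::] = f (size (f 0 x)).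
  have -> : f 0 x = s x by rewrite /f /upd eqxx drop0.
  by rewrite /f take_size drop_size take0 drop0; stacks.
have -> : f 0 x = s x by rewrite /f /upd eqxx drop0.
apply: runs_while => [i lt|| i lt].
- by rewrite /f /upd eqxx (drop_nth false lt).
- by rewrite /f /upd eqxx drop_size.
have hfx : f i x = nth false (s x) i :: drop i.+1 (s x).
  by rewrite /f /upd eqxx (drop_nth false lt).
have step (b : bool) : nth false (s x) i = b ->
    runs (Seq (Pop x) (Push b y)) (f i) (f i.+1) 2.
  move=> hb; have := runs_seq (runs_pop _) (runs_push _).
  move=> /(_ x b y (f i)); congr runs.
  rewrite hfx /= /f (take_nth false lt) rev_rcons hb.
  by stacks.
apply: runs_case; rewrite hfx.
by case: (nth false (s x) i) step => step; apply: step.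
Qed.

Lemma runs_pour2 {x y y'} s : x <> y -> x <> y' -> y <> y' ->
  runs (pour2 x y y') s
    (upd (upd (upd s y (rev (s x) ++ s y)) y' (rev (s x) ++ s y')) x [::])
    (size (s x) * 5).+1.
Proof.
move=> xy xy' yy'.
pose f i := upd (upd (upd s y (rev (take i (s x)) ++ s y))
  y' (rev (take i (s x)) ++ s y')) x (drop i (s x)).
have -> : s = f 0 by rewrite /f take0 drop0; stacks.
have -> : upd (upd (upd (f 0) y (rev (f 0 x) ++ f 0 y)) y' (rev (f 0 x) ++ f 0 y'))
    x [::] = f (size (f 0 x)).
  have -> : f 0 x = s x by rewrite /f /upd eqxx drop0.
  by rewrite /f take_size drop_size take0 drop0; stacks.
have -> : f 0 x = s x by rewrite /f /upd eqxx drop0.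
apply: runs_while => [i lt|| i lt].
- by rewrite /f /upd eqxx (drop_nth false lt).
- by rewrite /f /upd eqxx drop_size.
have hfx : f i x = nth false (s x) i :: drop i.+1 (s x).
  by rewrite /f /upd eqxx (drop_nth false lt).
have step (b : bool) : nth false (s x) i = b ->
    runs (Seq (Pop x) (Seq (Push b y) (Push b y'))) (f i) (f i.+1) 3.
  move=> hb; have := runs_seq (runs_pop _) (runs_seq (runs_push _) (runs_push _)).
  move=> /(_ x b y b y' (f i)); congr runs.
  rewrite hfx /= /f (take_nth false lt) rev_rcons hb.
  by stacks.
apply: runs_case; rewrite hfx.
by case: (nth false (s x) i) step => step; apply: step.
Qed.

Fixpoint shift k c :=
  match c with
  | Push b x => Push b (x + k)
  | Pop x => Pop (x + k)
  | Seq c1 c2 => Seq (shift k c1) (shift k c2)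
  | Case x c0 c1 c2 => Case (x + k) (shift k c0) (shift k c1) (shift k c2)
  | While x c => While (x + k) (shift k c)
  end.

Definition store_cat k (S s : store) : store :=
  fun x => if x < k then S x else s (x - k).

Lemma store_catE k S s x : store_cat k S s (x + k) = s x.
Proof. by rewrite /store_cat ltnNge leq_addl addnK. Qed.

Lemma upd_store_cat k S s x v :
  upd (store_cat k S s) (x + k) v = store_cat k S (upd s x v).
Proof.
apply/funext => y; rewrite /upd /store_cat.
case: eqP => [->|ne]; first by rewrite ltnNge leq_addl addnK eqxx.
by case: ltnP => // le; case: eqP => // e; case: ne; lia.
Qed.

Lemma exec_shift k S c s t s' : exec c s t s' ->
  exec (shift k c) (store_cat k S s) t (store_cat k S s').
Proof.
elim=> {c s t s'} /=.
- move=> b x s; have := exec_push b (x + k) (store_cat k S s).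
  by rewrite upd_store_cat store_catE.
- move=> x s; have := exec_pop (x + k) (store_cat k S s).
  by rewrite upd_store_cat store_catE.
- by move=> *; econstructor; eauto.
- move=> x c0 c1 c2 s s' t _ IH; constructor; rewrite store_catE.
  by case: (s x) IH => [|[] ?].
- by move=> x c s e; constructor; rewrite store_catE.
- by move=> *; econstructor; rewrite ?store_catE; eauto.
Qed.

Lemma store_cat_nth l s : store_cat (size l) (st l) (st s) = st (l ++ s).
Proof. by apply/funext => x; rewrite /store_cat nth_cat. Qed.

Fixpoint width c :=
  match c with
  | Push _ x | Pop x => x.+1
  | Seq c1 c2 => maxn (width c1) (width c2)
  | Case x c0 c1 c2 =>
      maxn x.+1 (maxn (width c0) (maxn (width c1) (width c2)))
  | While x c => maxn x.+1 (width c)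
  end.

Lemma exec_width c s t s' x : exec c s t s' -> width c <= x -> s' x = s x.
Proof.
elim=> {c s t s'} /=.
- by move=> b y s lt; rewrite /upd; case: eqP => // e; lia.
- by move=> y s lt; rewrite /upd; case: eqP => // e; lia.
- by move=> c1 c2 s1 s2 s3 t1 t2 _ h1 _ h2 le; rewrite h2 ?h1 //; lia.
- move=> y c0 c1 c2 s s' t _ h le; apply: h.
  by case: (s y) => [|[] ?]; lia.
- by [].
- by move=> y c s1 s2 s3 t1 t2 _ _ h1 _ h2 le; rewrite h2 ?h1 //; lia.
Qed.

Lemma exec_size c s t s' x : exec c s t s' -> size (s' x) <= size (s x) + t.
Proof.
elim=> {c s t s'} //=; try by move=> *; lia.
- by move=> b y s; rewrite /upd; case: eqP => [->|] /=; lia.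
- by move=> y s; rewrite /upd; case: eqP => [->|] /=; rewrite ?size_behead; lia.
Qed.

Fixpoint clear k n :=
  if n is n'.+1 then Seq (While k (Pop k)) (clear k.+1 n') else While k (Pop k).

Lemma runs_empty {x} s :
  runs (While x (Pop x)) s (upd s x [::]) (size (s x) * 2).+1.
Proof.
pose f i := upd s x (drop i (s x)).
have -> : upd s x [::] = f (size (s x)) by rewrite /f drop_size.
have {1}-> : s = f 0 by rewrite /f drop0; stacks.
apply: runs_while => [i lt|| i lt].
- by rewrite /f /upd eqxx (drop_nth false lt).
- by rewrite /f /upd eqxx drop_size.
have := runs_pop (f i) (x := x); congr runs.
have -> : f i x = drop i (s x) by rewrite /f /upd eqxx.
by rewrite -drop1 drop_drop add1n /f; stacks.
Qed.

Lemma runs_clear k n s M : (forall x, k <= x -> size (s x) <= M) ->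
  runs (clear k n) s (fun x => if k <= x <= k + n then [::] else s x)
    (n.+1 * (M * 2).+1).
Proof.
elim: n k s => [|n IHn] k s hM.
  rewrite /= mul1n; apply: (@runs_weak _ _ _ (size (s k) * 2).+1); last first.
    by have := hM k (leqnn k); lia.
  have := runs_empty s (x := k); congr runs; apply/funext => x.
  by rewrite /upd addn0 -eqn_leq eq_sym.
have := runs_seq (runs_empty s (x := k)) (IHn k.+1 (upd s k [::]) _).
move=> /(_ (ltac:(by move=> x lt; rewrite /upd; case: eqP => // _; apply: hM; lia))).
move=> h; apply: (@runs_weak _ _ _ _ _ _ _).
  move: h; congr runs; apply/funext => x; rewrite /upd.
  case: eqP => [->|/eqP ne]; first by rewrite leqnn leq_addr ltnn.
  by rewrite addSnnS ltn_neqAle eq_sym ne.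
by have := hM k (leqnn k); rewrite (mulSn n.+1); lia.
Qed.

Definition call k dst c :=
  Seq (shift k c) (Seq (pour k dst) (clear k (maxn (width c) 3))).

Definition call_time c (M t : nat) :=
  t + ((M + t) * 4 + 1 + (maxn (width c) 3).+1 * ((M + t) * 2).+1).

Lemma runs_call c ins t s' M main dst :
  exec c (st ins) t s' -> size ins <= 3 -> (forall x, size (st ins x) <= M) ->
  dst < size main ->
  runs (call (size main) dst c) (st (main ++ ins))
    (st (set_nth [::] main dst (rev (s' 0) ++ st main dst))) (call_time c M t).
Proof.
move=> he h3 hM hd; set k := size main.
pose s1 := store_cat k (st main) s'.
have h1 : runs (shift k c) (st (main ++ ins)) s1 t.
  by exists t => //; rewrite -store_cat_nth; apply: exec_shift.
have s1k : s1 k = s' 0 by rewrite /s1 -{2}(add0n k) store_catE.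
have s1d : s1 dst = st main dst by rewrite /s1 /store_cat hd.
have hs x : size (s' x) <= M + t.
  by apply: leq_trans (exec_size _ _ _ _ x he) _; rewrite leq_add2r.
have h2 : runs (pour k dst) s1
    (upd (upd s1 dst (rev (s' 0) ++ st main dst)) k [::]) ((M + t) * 4).+1.
  have kd : k <> dst by rewrite /k; lia.
  have := runs_pour s1 kd; rewrite s1k s1d => h; apply: runs_weak h _.
  by have := hs 0; lia.
have h3' := runs_clear k (maxn (width c) 3)
  (upd (upd s1 dst (rev (s' 0) ++ st main dst)) k [::]) (M + t) _.
apply: (@runs_weak _ _ _ _ _); first apply: runs_seq h1 (runs_seq h2 _).
  move: h3' => /(_ (ltac:(move=> x le; rewrite /upd; case: eqP => // _;
    case: eqP => [e|_]; [by subst; move: hd le; rewrite /k; lia|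
    by rewrite /s1 /store_cat ltnNge le /=; apply: hs]))).
  congr runs; apply/funext => x.
  rewrite -upd_nth /upd.
  case: (eqVneq x dst) => [->|nd].
    rewrite {1}[k <= _]leqNgt hd /=; case: eqP => // e; move: hd; rewrite -/k; lia.
  case: leqP => kx /=; last by rewrite /s1 /store_cat kx; case: eqP => // e; lia.
  rewrite [RHS]nth_default //.
  case: leqP => // lt; case: eqP => // _.
  rewrite /s1 /store_cat ltnNge kx /= (exec_width _ _ _ _ _ he); last by lia.
  by rewrite nth_default //; lia.
by rewrite /call_time; lia.
Qed.
Lemma nth_nil_cat n (l : seq bits) : st l = st (l ++ nseq n [::]).
Proof.
apply/funext => x; rewrite nth_cat; case: ltnP => // le.
by rewrite nth_nseq if_same nth_default.
Qed.

Lemma runs_push_nth b x l :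
  runs (Push b x) (st l) (st (set_nth [::] l x (b :: st l x))) 1.
Proof. by rewrite -upd_nth; apply: runs_push. Qed.

Lemma runs_pop_nth x l :
  runs (Pop x) (st l) (st (set_nth [::] l x (behead (st l x)))) 1.
Proof. by rewrite -upd_nth; apply: runs_pop. Qed.

Lemma runs_pour_nth x y l : x <> y ->
  runs (pour x y) (st l)
    (st (set_nth [::] (set_nth [::] l y (rev (st l x) ++ st l y)) x [::]))
    (size (st l x) * 4).+1.
Proof. by rewrite -!upd_nth; apply: runs_pour. Qed.

Lemma runs_pour2_nth x y y' l : x <> y -> x <> y' -> y <> y' ->
  runs (pour2 x y y') (st l)
    (st (set_nth [::] (set_nth [::] (set_nth [::] l y (rev (st l x) ++ st l y))
       y' (rev (st l x) ++ st l y')) x [::])) (size (st l x) * 5).+1.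
Proof. by rewrite -!upd_nth; apply: runs_pour2. Qed.

Lemma runs_while_stop {x c s} : s x = [::] -> runs (While x c) s s 1.
Proof. by exists 1 => //; constructor. Qed.

Lemma runs_while_step {x c s1 s2 s3 T1 T2} : s1 x <> [::] ->
  runs c s1 s2 T1 -> runs (While x c) s2 s3 T2 ->
  runs (While x c) s1 s3 (T1 + T2).+1.
Proof.
move=> ne [t1 e1 l1] [t2 e2 l2]; exists (t1 + t2).+1; last by lia.
exact: exec_while_step ne e1 e2.
Qed.

End Machine.

(** * Polynomial bounds and walks on blocks of bits *)

Section PolyBounded.
Local Open Scope nat_scope.

Lemma leq_expn2r m n d : m <= n -> m ^ d <= n ^ d.
Proof. by case: d => // d; rewrite leq_exp2r. Qed.

Lemma poly_boundedP f :
  poly_bounded f <-> exists d, forall n, f n <= (n + 2) ^ d.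
Proof.
split=> -[d hd].
  exists d.+1 => n; apply: leq_trans (hd n) _.
  have h1 : n ^ d <= (n + 2) ^ d by apply: leq_expn2r; lia.
  have h2 : d <= (n + 2) ^ d.
    by apply: ltnW; apply: ltn_expl; rewrite addn2.
  rewrite expnS; have : 2 * (n + 2) ^ d <= (n + 2) * (n + 2) ^ d.
    by rewrite leq_mul2r leq_addl orbT.
  lia.
exists (3 ^ d + 2 * d) => n; apply: leq_trans (hd n) _.
case: (leqP n 1) => [n1|n2].
  apply: (@leq_trans (3 ^ d)); last by lia.
  by apply: leq_expn2r; lia.
apply: (@leq_trans (n ^ (2 * d))).
  by rewrite expnM; apply: leq_expn2r; rewrite -mulnn; nia.
apply: leq_trans (leq_addr _ _); rewrite leq_exp2l //; lia.
Qed.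

Lemma poly_bounded_le f g :
  (forall n, f n <= g n) -> poly_bounded g -> poly_bounded f.
Proof. by move=> le [d hd]; exists d => n; apply: leq_trans (le n) _. Qed.

Lemma poly_bounded_const k : poly_bounded (fun=> k).
Proof. by exists k => n; rewrite leq_addl. Qed.

Lemma poly_bounded_id : poly_bounded id.
Proof. by exists 1 => n; rewrite expn1 leq_addr. Qed.

Lemma poly_boundedD f g :
  poly_bounded f -> poly_bounded g -> poly_bounded (fun n => f n + g n).
Proof.
move=> /poly_boundedP[d hd] /poly_boundedP[e he]; apply/poly_boundedP.
exists (maxn d e).+1 => n.
have hf : f n <= (n + 2) ^ maxn d e.
  by apply: leq_trans (hd n) _; rewrite leq_exp2l ?leq_maxl ?addn2.
have hg : g n <= (n + 2) ^ maxn d e.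
  by apply: leq_trans (he n) _; rewrite leq_exp2l ?leq_maxr ?addn2.
by rewrite expnS; nia.
Qed.

Lemma poly_boundedM f g :
  poly_bounded f -> poly_bounded g -> poly_bounded (fun n => f n * g n).
Proof.
move=> /poly_boundedP[d hd] /poly_boundedP[e he]; apply/poly_boundedP.
by exists (d + e) => n; rewrite expnD leq_mul.
Qed.

Lemma poly_boundedX f k : poly_bounded f -> poly_bounded (fun n => f n ^ k).
Proof.
move=> /poly_boundedP[d hd]; apply/poly_boundedP.
by exists (d * k) => n; rewrite expnM leq_expn2r.
Qed.

Lemma poly_boundedS f : poly_bounded f -> poly_bounded (fun n => (f n).+1).
Proof.
move=> hf; have := poly_boundedD _ _ hf (poly_bounded_const 1).
by apply: poly_bounded_le => n; rewrite addn1.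
Qed.

Lemma poly_bounded_size_poly_time (out : nat -> bits) :
  poly_time (fun n => [:: unary n]) out -> poly_bounded (fun n => size (out n)).
Proof.
move=> [c [d h]]; apply: (@poly_bounded_le _ (fun n => n + (n ^ d + d))); last first.
  exact: (poly_boundedD _ _ poly_bounded_id (ex_intro _ d (fun=> leqnn _))).
move=> n; have [t [s [he <-]]] := h n; rewrite /= size_nseq addn0 => le.
have := exec_size _ _ _ _ 0 he; rewrite /= size_nseq; lia.
Qed.

End PolyBounded.

Section Walk.
Local Open Scope nat_scope.
Variables (S : Type) (next : S -> bits -> S) (hit : S -> bits -> bool) (k : nat).

Fixpoint hits (n : nat) (s : S) (w : bits) : nat :=
  if n is n'.+1 then
    hit s (take k w) + hits n' (next s (take k w)) (drop k w)
  else 0.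

Lemma hits_le n s w : hits n s w <= n.
Proof. by elim: n s w => //= n IH s w; have := IH (next s (take k w)) (drop k w); lia. Qed.

Lemma hits_sum n (s : nat -> S) w :
  (forall j, j < n -> s j.+1 = next (s j) (take k (drop (j * k) w))) ->
  hits n (s 0) w = \sum_(j < n) hit (s j) (take k (drop (j * k) w)).
Proof.
elim: n s w => [|n IH] s w hs; first by rewrite big_ord0.
rewrite big_ord_recl /= mul0n drop0; congr (_ + _).
have := hs 0 isT; rewrite mul0n drop0 => <-.
rewrite (IH (fun j => s j.+1)) => [|j lt]; last first.
  by rewrite hs // drop_drop -mulSnr.
by apply: eq_bigr => j _; rewrite drop_drop -mulSnr.
Qed.

Definition nblocks (w : bits) := (size w + k.-1) %/ k.

Lemma nblocks_nil : 0 < k -> nblocks [::] = 0.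
Proof. by move=> k0; rewrite /nblocks add0n divn_small //=; lia. Qed.

Lemma nblocks_drop w : 0 < k -> w <> [::] -> nblocks w = (nblocks (drop k w)).+1.
Proof.
move=> k0 wne; have w0 : 0 < size w by case: w wne.
rewrite /nblocks size_drop; case: (leqP k (size w)) => le.
  by rewrite -[in LHS](subnK le) addnAC divnDr ?dvdnn // divnn k0 addn1.
have -> : size w - k = 0 by lia.
rewrite add0n (divn_small (m := k.-1)); last by lia.
have -> : size w + k.-1 = k + (size w).-1 by lia.
by rewrite divnDl ?dvdnn // divnn k0 divn_small //; lia.
Qed.

Lemma nblocks_mul n w : 0 < k -> size w = n * k -> nblocks w = n.
Proof. by move=> k0 hw; rewrite /nblocks hw divnMDl // divn_small ?addn0 //; lia. Qed.

Lemma nblocks_le w : 0 < k -> nblocks w <= size w.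
Proof.
move=> k0; rewrite /nblocks; case: (posnP (size w)) => [->|w0].
  by rewrite add0n divn_small //; lia.
by apply: (@leq_trans ((size w * k) %/ k)); [apply: leq_div2r; nia|rewrite mulnK].
Qed.
End Walk.

(** * The adversary that simulates Embed *)

Section Adversary.
Local Open Scope nat_scope.

Notation st l := (nth [::] l : store).

Lemma call_time_mono c M M' t t' :
  M <= M' -> t <= t' -> call_time c M t <= call_time c M' t'.
Proof. by move=> hM ht; rewrite /call_time; nia. Qed.

Lemma poly_bounded_call_time c M t : poly_bounded M -> poly_bounded t ->
  poly_bounded (fun n => call_time c (M n) (t n)).
Proof.
move=> hM ht; rewrite /call_time.
repeat first [apply: poly_boundedD | apply: poly_boundedS | apply: poly_boundedM
  | apply: poly_bounded_const | assumption].
Qed.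

Variables (ck cz cp : cmd) (dk dz dp : nat).
Variables (kf : nat -> nat) (zf : nat -> bits) (m : bool) (g : bits -> bits -> bool).
Hypothesis kf_gt0 : forall n, 0 < kf n.
Hypothesis ckP : forall n, exists t s,
  [/\ exec ck (st [:: unary n]) t s, s 0 = unary (kf n) & t <= n ^ dk + dk].
Hypothesis czP : forall n, exists t s,
  [/\ exec cz (st [:: unary n]) t s, s 0 = zf n & t <= n ^ dz + dz].
Hypothesis cpP : forall s r, exists t s',
  [/\ exec cp (st [:: s; [:: m]; r]) t s', s' 0 = [:: g s r]
    & t <= (size s + 1 + size r) ^ dp + dp].

(* [g s r] compares the number r with the probability of m after the bits s,
   so the sampler outputs m iff [g s r] holds.  The score then points to the
   signal other than m iff [g s r] agrees with the leading bit of r. *)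
Definition sample_next (s r : bits) : bits := rcons s (g s r == m).
Definition wrong_score (s r : bits) : bool := head false r == g s r.

Definition fetch_block :=
  While 4 (Seq (Pop 4) (Seq (Push true 5) (Case 1 (Pop 1)
    (Seq (Pop 1) (Push false 7)) (Seq (Pop 1) (Push true 7))))).

Definition account (wrong b : bool) :=
  Seq (Push true (if wrong then 3 else 2)) (Push (b == m) 6).

Definition round :=
  Seq fetch_block (Seq (pour 5 4) (Seq (pour 7 12)
  (Seq (Case 12 (Push false 8) (Push false 8) (Push true 8))
  (Seq (pour2 6 10 7) (Seq (pour 7 6) (Seq (Push m 11)
  (Seq (call 10 9 cp)
  (Seq (Case 9 (Pop 9)
          (Case 8 (Pop 8) (account true false) (account false false))
          (Case 8 (Pop 8) (account false true) (account true true)))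
  (Seq (Pop 8) (Pop 9)))))))))).

(* Stacks: 0 security parameter, later the verdict; 1 pseudorandom bits left;
   2 counts the right scores on top of the coins, 3 the wrong ones; 4 block
   length; 6 prompt and text, last bit on top; 8 leading bit of the block;
   9 answer of the predictor; 5 and 7 scratch; from 10 on, subroutine calls. *)
Definition adversary :=
  Seq (pour2 0 10 7) (Seq (call 10 4 ck) (Seq (pour 7 10) (Seq (call 10 6 cz)
  (Seq (While 1 round) (Seq (While 3 (Seq (Pop 3) (Pop 2)))
  (Case 2 (Push true 0) (Push false 0) (Push false 0))))))).

Local Arguments unary : simpl never.

Lemma unaryS n : unary n.+1 = true :: unary n. Proof. by []. Qed.

Lemma runs_fetch_block k w u v zr :
  runs fetch_block (st [:: [::]; w; u; v; unary k; [::]; zr])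
    (st [:: [::]; drop k w; u; v; [::]; unary k; zr; rev (take k w)]) (k * 6).+1.
Proof.
pose f i := st [:: [::]; drop i w; u; v; unary (k - i); unary i; zr; rev (take i w)].
have -> : st [:: [::]; w; u; v; unary k; [::]; zr] = f 0.
  by rewrite /f subn0 drop0 take0 (nth_nil_cat 1).
have -> : st [:: [::]; drop k w; u; v; [::]; unary k; zr; rev (take k w)] = f k.
  by rewrite /f subnn.
apply: runs_while => [i lt|| i lt].
- by rewrite /f /=; case: (k - i) (subn_gt0 i k) => [|?] //; rewrite lt.
- by rewrite /f /= subnn.
have hk : unary (k - i) = true :: unary (k - i.+1).
  by rewrite -unaryS; congr unary; lia.
rewrite {}/f hk; apply: (@runs_weak _ _ _ (1 + (1 + 3))) => //.
apply: runs_seq (runs_pop_nth _ _) _ => /=.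
apply: runs_seq (runs_push_nth _ _ _) _ => /=.
apply: runs_case => /=.
case: (leqP (size w) i) => hi.
  have hi1 : size w <= i.+1 by lia.
  rewrite !(drop_oversize hi, drop_oversize hi1, take_oversize hi, take_oversize hi1).
  by apply: (@runs_weak _ _ _ 1) => //; apply: runs_pop_nth.
rewrite (drop_nth false hi) (take_nth false hi) rev_rcons.
by case: (nth false w i); apply: (@runs_weak _ _ _ (1 + 1)) => //;
  apply: runs_seq (runs_pop_nth _ _) (runs_push_nth _ _ _).
Qed.


Definition round_time M k t :=
  (k * 6).+1 + ((k * 4).+1 + ((M * 4).+1 + (2 + ((M * 5).+1 + ((M * 4).+1
  + (1 + (call_time cp M t + (4 + 2)))))))).

Lemma runs_round k w u v s M t : 0 < k -> w <> [::] ->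
  size s < M -> size w <= M -> (M + M) ^ dp + dp <= t ->
  exists s' u' v',
  runs round (st [:: [::]; w; u; v; unary k; [::]; rev s])
    (st [:: [::]; drop k w; u'; v'; unary k; [::]; rev s']) (round_time M k t) /\
  [/\ s' = sample_next s (take k w),
    size u' = ~~ wrong_score s (take k w) + size u
    & size v' = wrong_score s (take k w) + size v].
Proof.
move=> k0 wne hs hw ht; set x := take k w.
have hx : size x <= M by rewrite /x size_take; case: ifP; lia.
pose wr := wrong_score s x.
exists (sample_next s x), (if wr then u else true :: u), (if wr then true :: v else v).
split; last by rewrite -/wr; case: wr.
apply: runs_seq (runs_fetch_block _ _ _ _ _) _ => /=.
apply: runs_seq.
  apply: (runs_weak (runs_pour_nth _ _ _ _)) => //=; by rewrite size_nseq.
move=> /=.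
apply: runs_seq.
  apply: (runs_weak (runs_pour_nth _ _ _ _)) => //=; rewrite size_rev -/x; lia.
rewrite /= !cats0 revK -/x.
apply: runs_seq (_ : runs _ _ (st [:: [::]; drop k w; u; v; rev (unary k); [::];
  rev s; [::]; [:: head false x]; [::]; [::]; [::]; x]) _) _.
  apply: runs_case; rewrite /=; case: (x) => [|[] x'] /=; exact: runs_push_nth.
apply: runs_seq.
  apply: (runs_weak (runs_pour2_nth _ _ _ _ _ _ _)) => //=; rewrite size_rev; lia.
rewrite /= revK cats0.
apply: runs_seq.
  apply: (runs_weak (runs_pour_nth _ _ _ _)) => //=; lia.
rewrite /= cats0.
apply: runs_seq (runs_push_nth _ _ _) _ => /=.
have [t' [s' [he hs' ht']]] := cpP s x.
have hc := runs_call _ _ _ _ M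
  [:: [::]; drop k w; u; v; rev (unary k); [::]; rev s; [::]; [:: head false x]; [::]]
  9 he.
apply: runs_seq.
  apply: runs_weak (hc _ _ _) _ => //.
  - do 3 (case => /=; [lia|]); by case.
  - apply: call_time_mono => //; apply: leq_trans ht' _; apply: leq_trans ht.
    by rewrite leq_add2r leq_expn2r //; lia.
rewrite hs' /=.
have -> : rev (unary k) = unary k by rewrite /unary rev_nseq.
apply: runs_seq (_ : runs _ _ (st [:: [::]; drop k w; if wr then u else true :: u;
  if wr then true :: v else v; unary k; [::]; rev (sample_next s x); [::];
  [:: head false x]; [:: g s x]]) _) _.
  rewrite /wr /wrong_score /sample_next rev_rcons.
  apply: runs_case => /=.
  by case: (g s x); apply: runs_case => /=; case: (head false x) => /=;
    apply: (@runs_weak _ _ _ (1 + 1)) => //;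
    apply: runs_seq (runs_push_nth _ _ _) (runs_push_nth _ _ _).
have := runs_seq (runs_pop_nth 8 _) (runs_pop_nth 9 _).
by move=> h; rewrite [X in runs _ _ X](nth_nil_cat 3); apply: h.
Qed.

Notation hits_ws := (hits _ sample_next wrong_score).

Lemma runs_rounds k n w u v s M t : 0 < k -> nblocks k w = n ->
  size s + n < M -> size w <= M -> (M + M) ^ dp + dp <= t ->
  exists s' u' v',
  [/\ runs (While 1 round) (st [:: [::]; w; u; v; unary k; [::]; rev s])
    (st [:: [::]; [::]; u'; v'; unary k; [::]; rev s'])
    (n * (round_time M k t).+1).+1,
    size u' + hits_ws k n s w = size u + n
    & size v' = size v + hits_ws k n s w].
Proof.
move=> k0; elim: n w u v s => [|n IH] w u v s hn hs hw ht.
  have -> : w = [::].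
    by case: w hn {hw} => // b w; rewrite nblocks_drop.
  exists s, u, v; split=> //=; last by rewrite addn0.
  exact: runs_while_stop.
have wne : w <> [::] by move=> e; move: hn; rewrite e nblocks_nil.
have hs1 : size s < M by lia.
have [s1 [u1 [v1 [h1 [e1 eu ev]]]]] := runs_round k w u v s M t k0 wne hs1 hw ht.
have hn1 : nblocks k (drop k w) = n by move: hn; rewrite nblocks_drop // => -[].
have hs2 : size s1 + n < M by rewrite e1 size_rcons; lia.
have hw2 : size (drop k w) <= M by rewrite size_drop; lia.
have [s2 [u2 [v2 [h2 eu2 ev2]]]] := IH (drop k w) u1 v1 s1 hn1 hs2 hw2 ht.
exists s2, u2, v2; split.
- apply: runs_weak (runs_while_step _ h1 h2) _ => //; rewrite mulSn; lia.
- by move: eu2; rewrite /= -e1 eu; case: (wrong_score _ _) => /=; lia.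
- by move: ev2; rewrite /= -e1 ev; lia.
Qed.

Lemma runs_compare u v l :
  exists s', runs (Seq (While 3 (Seq (Pop 3) (Pop 2)))
    (Case 2 (Push true 0) (Push false 0) (Push false 0)))
    (st [:: [::], [::], u, v & l]) s' (size v * 3 + 3)
  /\ s' 0 = [:: size u <= size v].
Proof.
pose f i := st [:: [::], [::], drop i u, drop i v & l].
have h1 : runs (While 3 (Seq (Pop 3) (Pop 2))) (f 0) (f (size v)) (size v * 3).+1.
  apply: runs_while => [i lt|| i lt].
  - by rewrite /f /= (drop_nth false lt).
  - by rewrite /f /= drop_size.
  have := runs_seq (runs_pop_nth 3 _) (runs_pop_nth 2 _).
  move=> /(_ [:: [::], [::], drop i u, drop i v & l]); congr runs.
  by rewrite /= /f -!drop1 !drop_drop add1n.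
rewrite {1}/f !drop0 in h1.
pose b := size u <= size v.
exists (upd (f (size v)) 0 [:: b]); split; last by rewrite /upd.
apply: (runs_weak (T := (size v * 3).+1 + 2)); last by lia.
apply: runs_seq h1 _; apply: runs_case; rewrite {1}/f /=.
have hp c : b = c -> runs (Push c 0) (f (size v)) (upd (f (size v)) 0 [:: b]) 1.
  by move=> ->; have := @runs_push c 0 (f (size v)).
case: (leqP (size u) (size v)) @b hp => [le|lt] b hp.
  by rewrite drop_oversize //; apply: hp.
rewrite (drop_nth false lt).
by case: (nth _ _ _); apply: hp.
Qed.

Definition adversary_verdict (lam : nat) (w u : bits) : bool :=
  size u + nblocks (kf lam) w <= 2 * hits_ws (kf lam) (nblocks (kf lam) w) (zf lam) w.

Definition text_bound (N : nat) := (N + (N ^ dz + dz) + N).+1.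

Definition adversary_time (N : nat) :=
  (N * 5).+1 + (call_time ck N (N ^ dk + dk) + ((N * 4).+1
  + (call_time cz N (N ^ dz + dz)
  + ((N * (round_time (text_bound N) (N + (N ^ dk + dk))
         ((text_bound N + text_bound N) ^ dp + dp)).+1).+1
  + (N * 3 + 3))))).

Lemma runs_adversary lam w u : exists s',
  runs adversary (st [:: unary lam; w; u]) s'
    (adversary_time (lam + (size w + size u)))
  /\ s' 0 = [:: adversary_verdict lam w u].
Proof.
set N := lam + _.
have ru n : rev (unary n) = unary n by rewrite /unary rev_nseq.
have su n : size (unary n) = n by rewrite size_nseq.
have [tk [sk [hk ek lk]]] := ckP lam.
have [tz [sz [hz ez lz]]] := czP lam.
have hN d : lam ^ d <= N ^ d by apply: leq_expn2r; lia.
have hkf : kf lam <= N + (N ^ dk + dk).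
  by have := exec_size _ _ _ _ 0 hk; rewrite ek /= !su; have := hN dk; lia.
have hzf : size (zf lam) <= N + (N ^ dz + dz).
  by have := exec_size _ _ _ _ 0 hz; rewrite ez /= !su; have := hN dz; lia.
have hnb := nblocks_le (kf lam) w (kf_gt0 lam).
have [s' [u' [v' [hr eu ev]]]] := runs_rounds (kf lam) _ w u [::] (zf lam)
  (text_bound N) _ (kf_gt0 lam) (erefl _)
  (ltac:(rewrite /text_bound; lia)) (ltac:(rewrite /text_bound; lia)) (leqnn _).
have [sf [hf ef]] := runs_compare u' v' [:: unary (kf lam); [::]; rev s'].
exists sf; split; last first.
  rewrite ef /adversary_verdict; congr [:: _].
  by move: eu ev; rewrite add0n; set h := hits _ _ _ _ _ _ _; lia.
have hins x : size (st [:: unary lam] x) <= N.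
  by case: x => [|x] /=; rewrite ?su ?nth_nil /N /=; lia.
apply: runs_seq.
  apply: (runs_weak (runs_pour2_nth _ _ _ _ _ _ _)) => //=; rewrite su; lia.
rewrite /= ru cats0.
have hck := runs_call _ _ _ _ N
  [:: [::]; w; u; [::]; [::]; [::]; [::]; unary lam; [::]; [::]] 4 hk isT hins isT.
apply: runs_seq.
  apply: runs_weak hck _; apply: call_time_mono => //.
  by apply: leq_trans lk _; rewrite leq_add2r.
rewrite ek ru /= cats0.
apply: runs_seq.
  apply: (runs_weak (runs_pour_nth _ _ _ _)) => //=; rewrite su; lia.
rewrite /= ru cats0.
have hcz := runs_call _ _ _ _ N
  [:: [::]; w; u; [::]; unary (kf lam); [::]; [::]; [::]; [::]; [::]] 6 hz isT hins isT.
apply: runs_seq.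
  apply: runs_weak hcz _; apply: call_time_mono => //.
  by apply: leq_trans lz _; rewrite leq_add2r.
rewrite ez /= cats0.
rewrite (nth_nil_cat 3) /= in hr.
apply: runs_weak (runs_seq hr hf) _; rewrite /adversary_time.
apply: leq_add.
  rewrite ltnS; apply: leq_mul; first by lia.
  rewrite ltnS /round_time; lia.
rewrite leq_add2r; have := hits_le _ sample_next wrong_score (kf lam) (nblocks (kf lam) w) (zf lam) w.
by move: ev => /=; lia.
Qed.

Lemma adversary_verdict_poly_time : poly_time_adversary adversary_verdict.
Proof.
have [d hd] : poly_bounded adversary_time.
  have hX f a : poly_bounded f -> poly_bounded (fun N => f N ^ a + a).
    by move=> hf; apply: poly_boundedD (poly_boundedX _ _ hf) (poly_bounded_const _).
  have hI := poly_bounded_id.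
  have ht : poly_bounded text_bound.
    exact: poly_boundedS (poly_boundedD _ _ (poly_boundedD _ _ hI (hX _ _ hI)) hI).
  rewrite /adversary_time /round_time.
  repeat first [apply: poly_bounded_call_time | apply: poly_boundedS
    | apply: (hX) | apply: poly_boundedD | apply: poly_boundedM
    | apply: poly_bounded_const | exact: ht | exact: hI].
exists adversary, d => -[[lam w] u].
have [s' [[t he ht] e0]] := runs_adversary lam w u.
exists t, s'; split=> //; apply: leq_trans ht (leq_trans (hd _) _).
by rewrite /= /unary size_nseq addn0.
Qed.

End Adversary.

(** * Sums over bit strings and uniform probabilities *)

Section BitSums.
Variable R : realType.

Fixpoint bsum (n : nat) (f : bits -> R) : R :=
  if n is n'.+1 then
    bsum n' (fun w => f (false :: w)) + bsum n' (fun w => f (true :: w))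
  else f [::].

Lemma sum_tuple_bsum n (f : bits -> R) : \sum_(t : n.-tuple bool) f t = bsum n f.
Proof.
elim: n f => [|n IH] f /=.
  by rewrite (big_pred1 [tuple]) // => t; rewrite (tuple0 t); apply/eqP.
rewrite -!IH.
pose h (p : bool * n.-tuple bool) := [tuple of p.1 :: p.2].
have hK : {on predT, bijective h}.
  exists (fun t => (thead t, [tuple of behead t])) => [[b t]|t] _.
    by rewrite /h theadE; congr pair; apply/val_inj.
  by rewrite /h /= [RHS]tuple_eta.
rewrite (reindex h hK) -(pair_bigA _ (fun b (t : n.-tuple bool) => f (b :: t))) /=.
by rewrite big_bool /= addrC.
Qed.

Lemma bsum_le n f g : (forall w, size w = n -> f w <= g w) -> bsum n f <= bsum n g.
Proof.
elim: n f g => [|n IH] f g h /=; first exact: h.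
by apply: lerD; apply: IH => w hw; apply: h; rewrite /= hw.
Qed.

Lemma bsumZr n f c : bsum n (fun w => f w * c) = bsum n f * c.
Proof. by elim: n f => //= n IH f; rewrite !IH mulrDl. Qed.

Lemma bsum_const n c : bsum n (fun=> c) = 2 ^+ n * c.
Proof. by elim: n => [|n /= ->]; rewrite ?mul1r // exprS; ring. Qed.

Lemma bsumD n f g : bsum n (fun w => f w + g w) = bsum n f + bsum n g.
Proof. by elim: n f g => //= n IH f g; rewrite !IH; ring. Qed.

Lemma bsum_cat n n' f :
  bsum (n + n') f = bsum n (fun x => bsum n' (fun y => f (x ++ y))).
Proof. by elim: n f => //= n IH f; rewrite !IH. Qed.

End BitSums.

Section Probability.
Variable R : realType.

Lemma Pr_sum (T : finType) (E : T -> Prop) :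
  Pr R E = (\sum_t (`[< E t >])%:R) / #|T|%:R.
Proof.
by rewrite /Pr -sum1_card natr_sum big_mkcond /=; congr (_ / _);
  apply: eq_bigr => t _; rewrite inE; case: ifP => // ->.
Qed.

Lemma Pr_le (T : finType) (E F : T -> Prop) :
  (forall x, E x -> F x) -> Pr R E <= Pr R F.
Proof.
move=> h; rewrite !Pr_sum ler_wpM2r ?invr_ge0 //; apply: ler_sum => t _.
by rewrite ler_nat; case: asboolP => // /h /asboolP ->.
Qed.

Lemma Pr_exists (T I : finType) (E : T -> Prop) (F : I -> T -> Prop) :
  (forall x, E x -> exists i, F i x) -> Pr R E <= \sum_i Pr R (F i).
Proof.
move=> h; rewrite (eq_bigr _ (fun i _ => Pr_sum _ (F i))) -mulr_suml Pr_sum.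
rewrite ler_wpM2r ?invr_ge0 // exchange_big /=; apply: ler_sum => t _.
case: asboolP => [/h[i hi]|_]; last by rewrite sumr_ge0.
rewrite (bigD1 i) //=; case: asboolP => // _.
by rewrite lerDl sumr_ge0.
Qed.

Lemma Pr_fst (T1 T2 : finType) (E : T1 -> Prop) : (0 < #|T2|)%N ->
  Pr R (fun x : T1 * T2 => E x.1) = Pr R E.
Proof.
move=> h; rewrite !Pr_sum card_prod natrM.
rewrite -(pair_bigA _ (fun x (_ : T2) => (`[< E x >])%:R)) /=.
under eq_bigr do rewrite sumr_const -[_ *+ #|_|]mulr_natr.
rewrite -mulr_suml invfM mulrACA mulfV ?mulr1 //.
by rewrite pnatr_eq0 -lt0n.
Qed.

Lemma Pr_prod_le (T1 T2 : finType) (E : T1 * T2 -> Prop) c : 0 <= c ->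
  (forall x, Pr R (fun y => E (x, y)) <= c) -> Pr R E <= c.
Proof.
move=> c0 h; rewrite Pr_sum card_prod.
have [->|] := posnP (#|T1| * #|T2|)%N; first by rewrite invr0 mulr0.
rewrite muln_gt0 => /andP[h1 h2].
rewrite ler_pdivrMr ?ltr0n ?muln_gt0 ?h1 // natrM.
rewrite (eq_bigr (fun p => (`[< E (p.1, p.2) >])%:R)) => [|[] //].
rewrite -(pair_bigA _ (fun x y => (`[< E (x, y) >])%:R : R)) /=.
have -> : c * (#|T1|%:R * #|T2|%:R) = \sum_(x : T1) c * #|T2|%:R.
  by rewrite sumr_const -mulr_natr; ring.
by apply: ler_sum => x _; rewrite -ler_pdivrMr ?ltr0n // -Pr_sum.
Qed.

Lemma Pr_tuple n (E : bits -> Prop) :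
  Pr R (fun t : n.-tuple bool => E t) =
  bsum R n (fun w => (`[< E w >])%:R) / 2 ^+ n.
Proof.
rewrite Pr_sum card_tuple card_bool natrX; congr (_ / _).
exact: (sum_tuple_bsum _ _ (fun w => (`[< E w >])%:R)).
Qed.

End Probability.

Section Tail.
Variable R : realType.
Implicit Types t x e : R.

Lemma cosh_le t : expR t + expR (- t) <= 2 * expR (2 * t ^+ 2).
Proof.
wlog t0 : t / 0 <= t.
  move=> h; have [|/ltW t0] := leP 0 t; first exact: h.
  by have := h (- t); rewrite oppr_ge0 opprK sqrrN addrC => ->.
have [th|th] := leP t (1 / 2); last first.
  have h1 : expR t <= expR (2 * t ^+ 2) by rewrite ler_expR; nra.
  have h2 : expR (- t) <= expR (2 * t ^+ 2) by rewrite ler_expR; nra.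
  lra.
have h1 : expR t <= (1 - t)^-1.
  rewrite -[t in expR t]opprK expRN lef_pV2 ?posrE ?expR_gt0 //; last by lra.
  exact: expR_ge1Dx.
have h2 : expR (- t) <= (1 + t)^-1.
  by rewrite expRN lef_pV2 ?posrE ?expR_gt0 ?expR_ge1Dx //; lra.
have h3 : 1 + 2 * t ^+ 2 <= expR (2 * t ^+ 2) by exact: expR_ge1Dx.
have h4 : (1 - t)^-1 + (1 + t)^-1 = 2 / (1 - t ^+ 2).
  by field; apply/and3P; split; apply: lt0r_neq0; nra.
have h5 : (1 - t ^+ 2)^-1 <= 1 + 2 * t ^+ 2.
  have hs : t ^+ 2 <= 1 / 4 by nra.
  have hs0 := sqr_ge0 t.
  by rewrite -[_^-1]mul1r ler_pdivrMr; nra.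
lra.
Qed.
End Tail.

(** * Deviation of the scores *)

Section WalkTail.
Variables (R : realType) (S : Type) (next : S -> bits -> S).
Variables (hit : S -> bits -> bool) (k : nat).
Hypothesis k_gt0 : (0 < k)%N.
(* Flipping the leading bit of a block pairs every hit with a miss. *)
Hypothesis hit_flip : forall s x,
  size x = k.-1 -> ~~ (hit s (false :: x) && hit s (true :: x)).

Notation walk n s w := ((hits _ next hit k n s w).*2%:R - n%:R : R).

Lemma walk_mgf n n' s (t : R) : 0 <= t ->
  bsum R (n * k + n') (fun w => expR (t * walk n s w)) <=
  2 ^+ (n * k + n') * expR (2 * t ^+ 2 * n%:R).
Proof.
move=> t0; elim: n s => [|n IH] s.
  under [X in bsum _ _ X]funext do rewrite /= subrr mulr0.
  by rewrite bsum_const mulr0.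
rewrite mulSn -addnA bsum_cat.
pose c := 2 ^+ (n * k + n') * expR (2 * t ^+ 2 * n%:R).
have c0 : 0 <= c by rewrite mulr_ge0 ?exprn_ge0 ?expR_ge0.
apply: (@le_trans _ _
  (bsum R k (fun x => expR (t * ((hit s x).*2%:R - 1)) * c))).
  apply: bsum_le => x hx; apply: le_trans (_ : _ <=
      bsum R (n * k + n') (fun w => expR (t * walk n (next s x) w) *
        expR (t * ((hit s x).*2%:R - 1)))) _; last first.
    by rewrite bsumZr mulrC ler_wpM2l ?expR_ge0.
  apply: bsum_le => w _; rewrite -expRD /= take_size_cat // drop_size_cat //.
  rewrite ler_expR -mulrDr le_eqVlt; apply/orP; left; apply/eqP; congr (_ * _).
  by rewrite doubleD natrD -[in n.+1%:R]addn1 natrD; ring.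
have -> : bsum R k = bsum R k.-1.+1 by rewrite prednK.
rewrite bsumZr /= -bsumD.
have -> : 2 ^+ (k + (n * k + n')) * expR (2 * t ^+ 2 * n.+1%:R) =
    2 ^+ k.-1 * (2 * expR (2 * t ^+ 2)) * c.
  by rewrite /c -[n.+1]addn1 natrD mulrDr mulr1 expRD exprD -{1}(prednK k_gt0) exprS; ring.
rewrite ler_wpM2r // -bsum_const; apply: bsum_le => x hx.
have hE (b : bool) :
    expR (t * (b.*2%:R - 1)) = if b then expR t else expR (- t).
  by case: b; congr expR; rewrite -mul2n ?muln1 ?muln0; ring.
rewrite !hE; have hc := cosh_le R t; have := hit_flip s x hx.
case: (hit _ _); case: (hit _ _) => //= _; rewrite 1?addrC //.
apply: le_trans hc; rewrite lerD2r ler_expR; lra.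
Qed.

Lemma walk_tail n n' s d : (0 < n)%N ->
  bsum R (n * k + n') (fun w => (d + n <= (hits _ next hit k n s w).*2)%N%:R) <=
  2 ^+ (n * k + n') * expR (- (d%:R ^+ 2 / (8 * n%:R))).
Proof.
move=> n0; have n0R : 0 < n%:R :> R by rewrite ltr0n.
pose t : R := d%:R / (4 * n%:R).
have t0 : 0 <= t by rewrite divr_ge0 // mulr_ge0.
apply: (@le_trans _ _ (bsum R (n * k + n')
    (fun w => expR (t * walk n s w) * expR (- (t * d%:R))))).
  apply: bsum_le => w _; case: leqP => h; last first.
    by rewrite -expRD expR_ge0.
  rewrite -expRD -mulrBr -[1%:R]/1 -{1}[1]expR0 ler_expR mulr_ge0 //.
  by move: h; rewrite -(ler_nat R) natrD; lra.
rewrite bsumZr; apply: le_trans (ler_wpM2r (expR_ge0 _) (walk_mgf n n' s t t0)) _.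
rewrite -[X in X <= _]mulrA -expRD ler_wpM2l ?exprn_ge0 // ler_expR le_eqVlt.
by apply/orP; left; apply/eqP; rewrite /t; field; apply: lt0r_neq0.
Qed.

End WalkTail.

Section Deviation.
Variable R : realType.
Implicit Types e : R.

(* Least deviation at which the loops stop after n rounds, and n + 1 (a value
   out of reach) when there is none. *)
Definition stop_dev e (n : nat) : nat :=
  find (fun d => expR (- (d%:R ^+ 2 / (2 * n%:R))) < e) (iota 0 n.+1).

Lemma stop_dev_le e n : (stop_dev e n <= n.+1)%N.
Proof. by rewrite -[X in (_ <= X)%N](size_iota 0); apply: find_size. Qed.

Lemma stop_dev_min e n d : (d <= n)%N ->
  expR (- (d%:R ^+ 2 / (2 * n%:R))) < e -> (stop_dev e n <= d)%N.
Proof.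
move=> dn hd; rewrite leqNgt; apply/negP => /(before_find 0%N).
by rewrite nth_iota // add0n hd.
Qed.

Definition tail_bound e : R := Num.sqrt (Num.sqrt e).

Lemma stop_dev_tail (S : Type) next hit k n n' (s : S) e : (0 < k)%N ->
  (forall s x, size x = k.-1 -> ~~ (hit s (false :: x) && hit s (true :: x))) ->
  0 < e < 1 ->
  bsum R (n * k + n')
    (fun w => (stop_dev e n + n <= (hits _ next hit k n s w).*2)%N%:R) <=
  2 ^+ (n * k + n') * tail_bound e.
Proof.
move=> k0 hf /andP[e0 e1]; have [le|lt] := leqP (stop_dev e n) n; last first.
  apply: (@le_trans _ _ (bsum R (n * k + n') (fun=> 0))).
    apply: bsum_le => w _; case: leqP => // h.
    by have := hits_le _ next hit k n s w; move: h lt; lia.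
  by rewrite bsum_const mulr0 mulr_ge0 ?exprn_ge0 ?sqrtr_ge0.
set d := stop_dev e n in le *.
have hd : expR (- (d%:R ^+ 2 / (2 * n%:R))) < e.
  have : has (fun d => expR (- (d%:R ^+ 2 / (2 * n%:R))) < e) (iota 0 n.+1).
    by rewrite has_find size_iota ltnS.
  by move=> /(nth_find 0%N); rewrite nth_iota.
have n0 : (0 < n)%N.
  case: n @d le hd => // d; rewrite leqn0 => /eqP ->.
  by rewrite expr0n mul0r oppr0 expR0; lra.
apply: le_trans (walk_tail _ _ _ _ _ k0 hf _ _ _ _ n0) _.
rewrite ler_wpM2l ?exprn_ge0 // -(@ler_pXn2r _ 4) ?nnegrE ?expR_ge0 ?sqrtr_ge0 //.
have -> : tail_bound e ^+ 4 = e.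
  by rewrite /tail_bound (exprM _ 2 2) !sqr_sqrtr ?sqrtr_ge0 // ltW.
apply: ltW; apply: le_lt_trans hd; rewrite -expRM_natl ler_expR le_eqVlt.
apply/orP; left; apply/eqP; field.
by rewrite pnatr_eq0 -lt0n.
Qed.

Lemma stopped_dev e (r : nat -> R) (b : bits) : 0 < e < 1 -> stopped e r b ->
  (stop_dev e (size b) + size b <=
   (\sum_(n < size b) (detect_1bit (nth false b n) (r n) ==
                       ~~ (mean_score r b < 1 / 2)%R))%N.*2)%N.
Proof.
move=> /andP[e0 e1] hs; set n := size b; set m := ~~ _.
pose f (i : 'I_n) := detect_1bit (nth false b i) (r i).
have n0 : (0 < n)%N.
  rewrite lt0n; apply/negP => /eqP hn; move: hs.
  by rewrite /stopped -/n hn mulr0 mul0r expR0; lra.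
have n0R : 0 < n%:R :> R by rewrite ltr0n.
have hmean : \sum_(i < n) (f i : nat)%:R = n%:R * mean_score r b.
  by rewrite /mean_score -/n mulrCA mulfV ?mulr1 // lt0r_neq0.
set c := (\sum_(i < n) (f i == m))%N.
have cn : (c <= n)%N.
  by rewrite -[X in (_ <= X)%N]card_ord -sum1_card leq_sum // => i _; case: (_ == _).
have hc : c.*2%:R - n%:R = 2 * n%:R * `|mean_score r b - 1 / 2| :> R.
  rewrite -mul2n natrM natr_sum /m; case: ltP => hm /=.
    rewrite (eq_bigr (fun i => 1 - (f i : nat)%:R)); last first.
      by move=> i _; case: (f i); rewrite /= ?subrr ?subr0.
    rewrite sumrB hmean sumr_const card_ord ltr0_norm; last by lra.
    by field.
  rewrite (eq_bigr (fun i => (f i : nat)%:R : R)); last by move=> i _; case: (f i).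
  by rewrite hmean ger0_norm; [by field|lra].
have hn2 : (n <= c.*2)%N.
  by rewrite -(ler_nat R) -subr_ge0 hc mulr_ge0 ?mulr_ge0.
rewrite -(subnK hn2) leq_add2r; apply: stop_dev_min; first by lia.
rewrite natrB // hc; move: hs; rewrite /stopped -/n; congr (expR _ < _).
rewrite exprMn real_normK ?num_real //; field.
by rewrite lt0r_neq0.
Qed.

End Deviation.

(** * The watermarking scheme *)

Section Negligible.
Variable R : realType.
Implicit Types f g : nat -> R.

Lemma neglM_poly (p : nat -> nat) f :
  poly_bounded p -> negl f -> negl (fun n => (p n)%:R * f n).
Proof.
move=> /poly_boundedP[d hd] hf c; have [N hN] := hf (c + 2 * d)%N.
exists (maxn N 2) => n; rewrite geq_max => /andP[/hN hn n2].
have n0 : 0 < n%:R :> R by rewrite ltr0n; lia.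
rewrite normrM ger0_norm //; apply: (@le_lt_trans _ _ (n%:R ^+ (2 * d) * `|f n|)).
  rewrite ler_wpM2r // -natrX ler_nat; apply: leq_trans (hd n) _.
  by rewrite expnM; apply: leq_expn2r; rewrite -mulnn; nia.
apply: (@lt_le_trans _ _ (n%:R ^+ (2 * d) * n%:R ^- (c + 2 * d))).
  by rewrite ltr_pM2l // exprn_gt0.
by rewrite exprD invfM mulrCA mulfV ?mulr1 // lt0r_neq0 // exprn_gt0.
Qed.

Lemma neglD f g : negl f -> negl g -> negl (fun n => f n + g n).
Proof.
move=> hf hg c.
have [N hN] := neglM_poly _ _ (poly_bounded_const 2) hf c.
have [M hM] := neglM_poly _ _ (poly_bounded_const 2) hg c.
exists (maxn N M) => n; rewrite geq_max => /andP[/hN + /hM].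
rewrite !normrM normr_nat; have := ler_normD (f n) (g n); lra.
Qed.

Lemma negl_sqrt f : (forall n, 0 <= f n) -> negl f -> negl (fun n => Num.sqrt (f n)).
Proof.
move=> f0 hf c; have [N hN] := hf (c * 2)%N; exists N => n /hN.
rewrite !ger0_norm ?sqrtr_ge0 // => h.
by rewrite -(@ltr_pXn2r _ 2) ?nnegrE ?sqrtr_ge0 ?invr_ge0 ?exprn_ge0 // exprVn -exprM sqr_sqrtr.
Qed.

Lemma negl_tail_bound f : (forall n, 0 <= f n) -> negl f ->
  negl (fun n => tail_bound R (f n)).
Proof.
move=> f0 hf; apply: negl_sqrt => [n|]; first exact: sqrtr_ge0.
exact: negl_sqrt.
Qed.

End Negligible.

Section Scheme.
Variable R : realType.

Lemma binary_fraction_cons b x :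
  binary_fraction R (b :: x) = (b%:R + binary_fraction R x) / 2.
Proof.
rewrite /binary_fraction big_ord_recl /= expr1 mulrDl; congr (_ + _).
by rewrite mulr_suml; apply: eq_bigr => i _; rewrite /= exprS invfM; ring.
Qed.

Lemma binary_fraction_itv x : 0 <= binary_fraction R x < 1.
Proof.
elim: x => [|b x IH]; first by rewrite /binary_fraction big_ord0 lexx ltr01.
by move/andP: IH => [? ?]; rewrite binary_fraction_cons; apply/andP; case: b => /=; lra.
Qed.

Lemma binary_fraction_half x : (0 < size x)%N ->
  (binary_fraction R x < 1 / 2) = ~~ head false x.
Proof.
case: x => // b x _; rewrite binary_fraction_cons /=.
have /andP[h0 h1] := binary_fraction_itv x.
by case: b => /=; [apply/negbTE; rewrite -leNgt|apply/eqP; rewrite eqb_id]; lra.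
Qed.

Definition below_prob (P : predictor_fun R) (m : bool) (s r : bits) : bool :=
  binary_fraction R r <= P s m.

Lemma wrong_score_flip P m s x :
  ~~ (wrong_score (below_prob P m) s (false :: x) &&
      wrong_score (below_prob P m) s (true :: x)).
Proof.
rewrite /wrong_score /below_prob !binary_fraction_cons /=.
by case: leP => h1; case: leP => h2 //; exfalso; lra.
Qed.

Lemma wat_samplerE (P : predictor_fun R) m s r :
  wat_sampler (P s) m (binary_fraction R r) = (below_prob P m s r == m).
Proof. by rewrite /wat_sampler /below_prob; case: m; case: ifP. Qed.

Lemma wrong_scoreE P m s r : (0 < size r)%N ->
  wrong_score (below_prob P m) s r =
  (detect_1bit (below_prob P m s r == m) (binary_fraction R r) == m).
Proof.
move=> r0; rewrite /wrong_score /detect_1bit binary_fraction_half //.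
by case: (head _ _); case: (below_prob _ _ _ _); case: m.
Qed.

Lemma embed_loopP P e (r : nat -> R) z m fuel b0 b :
  embed_loop P e r z m fuel b0 = Some b ->
  [/\ (size b0 < size b)%N, take (size b0) b = b0,
      forall n, (size b0 <= n < size b)%N ->
        nth false b n = wat_sampler (P (z ++ take n b)) m (r n),
      stopped e r b
    & forall n, (size b0 < n < size b)%N -> ~~ stopped e r (take n b)].
Proof.
elim: fuel b0 => //= fuel IH b0.
set c := wat_sampler _ _ _; case: ifP => hs.
  move=> [<-]; rewrite size_rcons; split=> //.
  - by rewrite -cats1 take_size_cat.
  - move=> n hn; have -> : n = size b0 by lia.
    by rewrite nth_rcons ltnn eqxx -cats1 take_size_cat.
  - by move=> n; lia.
move=> /IH; rewrite size_rcons => -[h1 h2 h3 h4 h5].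
have h0 : take (size b0) b = b0.
  have := congr1 (take (size b0)) h2.
  by rewrite take_takel // -cats1 take_size_cat.
split=> //; first by lia.
- move=> n /andP[]; rewrite leq_eqVlt => /orP[/eqP <- _|lt lt']; last first.
    by apply: h3; rewrite lt.
  have := congr1 (nth false ^~ (size b0)) h2.
  by rewrite nth_take // nth_rcons ltnn eqxx h0.
- move=> n /andP[]; rewrite leq_eqVlt => /orP[/eqP <- _|lt lt'].
    by rewrite h2 hs.
  by apply: h5; rewrite lt.
Qed.

Lemma detect_stopped (W : scheme R) lam sk b (r := prg_number W lam sk) :
  (0 < size b)%N -> stopped (threshold W lam) r b ->
  (forall n, (0 < n < size b)%N -> ~~ stopped (threshold W lam) r (take n b)) ->
  (detect W lam sk b).1 = Some (mean_score r b < 1 / 2).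
Proof.
move=> b0 hs hn; rewrite /detect -/r.
have -> : iota 1 (size b) = rcons (iota 1 (size b).-1) (size b).
  by have := iotaD 1 (size b).-1 1; rewrite addn1 add1n prednK //= cats1.
rewrite filter_rcons take_size hs.
rewrite (eq_in_filter (a2 := pred0)) ?filter_pred0 /= ?take_size // => n.
by rewrite mem_iota => h; apply/negbTE/hn; lia.
Qed.

Lemma mkseq_block (f : nat -> bool) n k j : (j < n)%N ->
  take k (drop (j * k) (mkseq f (n * k))) = mkseq (fun l => f (j * k + l)%N) k.
Proof.
move=> jn; rewrite /mkseq -map_drop -map_take drop_iota take_iota add0n.
have -> : minn k (n * k - j * k) = k.
  by apply/minn_idPl; rewrite -mulnBl leq_pmull // subn_gt0.
by rewrite -[X in iota X](addn0 (j * k)) iotaDl -map_comp.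
Qed.

(* The wrong scores exceed the right ones by at least the stopping deviation;
   the sum on the left avoids a truncated subtraction. *)
Definition deviates (W : scheme R) (lam : nat) (z : bits) (m : bool) (n : nat)
    (w : bits) : bool :=
  (stop_dev R (threshold W lam) n + n <=
   (hits _ (sample_next m (below_prob (predictor W) m))
      (wrong_score (below_prob (predictor W) m)) (block_len W lam) n z w).*2)%N.

Lemma embed_wrong_deviates (W : scheme R) lam sk z m b :
  0 < threshold W lam < 1 -> (0 < block_len W lam)%N ->
  embed W lam sk z m b -> (detect W lam sk b).1 <> Some m ->
  deviates W lam z m (size b) (prg_prefix (prg W) sk (size b * block_len W lam)).
Proof.
move=> e01 k0 [fuel /embed_loopP [b0 _ hb hs hn]] hd.
set r := prg_number W lam sk in hb hs hn.
have hm : ~~ (mean_score r b < 1 / 2) = m.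
  move: hd; rewrite detect_stopped // -/r.
  by case: (_ < _); case: m {hb} => // h; case: h.
have := stopped_dev R _ r b e01 hs; rewrite hm /deviates.
congr (_ <= _.*2)%N; symmetry.
set k := block_len W lam in k0 *; set n := size b.
have hblk (j : 'I_n) : binary_fraction R
    (take k (drop (j * k) (prg_prefix (prg W) sk (n * k)))) = r j.
  by rewrite mkseq_block.
pose s j := z ++ take j b.
have {1}-> : z = s 0%N by rewrite /s take0 cats0.
rewrite hits_sum; last first.
  move=> j jn; rewrite /sample_next -wat_samplerE (hblk (Ordinal jn)) /s.
  by rewrite (take_nth false jn) -rcons_cat hb.
apply: eq_bigr => j _; rewrite wrong_scoreE.
  by rewrite -wat_samplerE hblk hb //=.
by rewrite mkseq_block // size_mkseq.
Qed.

End Scheme.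

Section Uniform.
Variable R : realType.

Lemma tail_bound_gt0 (e : R) : 0 < e -> 0 < tail_bound R e.
Proof. by move=> e0; rewrite !sqrtr_gt0. Qed.

Lemma Pr_deviates (W : scheme R) lam z m n :
  0 < threshold W lam < 1 -> (0 < block_len W lam)%N ->
  Pr R (fun w : (n * block_len W lam).-tuple bool => deviates R W lam z m n w) <=
  tail_bound R (threshold W lam).
Proof.
move=> e01 k0.
rewrite (Pr_tuple R _ (deviates R W lam z m n)) ler_pdivrMr ?exprn_gt0 // mulrC.
rewrite -[(n * _)%N]addn0.
apply: le_trans (_ : _ <= _) (stop_dev_tail _ _ _ _ _ n 0 z _ k0 _ e01).
  by apply: bsum_le => w _; rewrite asboolb; apply: lexx.
by move=> s x _; apply: wrong_score_flip.
Qed.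

Lemma Pr_detect_uniform (W : scheme R) lam sk len : 0 < threshold W lam < 1 ->
  Pr R (fun b : len.-tuple bool => (detect W lam sk b).1 <> None) <=
  (len.+1 * 2)%:R * tail_bound R (threshold W lam).
Proof.
move=> e01; set e := threshold W lam in e01 *; set r := prg_number W lam sk.
pose score (m : bool) n (x : bits) := detect_1bit (head false x) (r n) == m.
pose F (p : 'I_len.+1 * bool) (b : bits) : Prop := (stop_dev R e p.1 + p.1 <=
  (hits _ (fun n _ => n.+1) (score p.2) 1 p.1 0%N b).*2)%N.
apply: le_trans (Pr_exists R _ _ _ (fun p (t : len.-tuple bool) => F p t) _) _.
  move=> b; rewrite /detect -/e -/r.
  case hi: [seq _ <- _ | _] => [|i l] // _.
  have : i \in i :: l by rewrite inE eqxx.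
  rewrite -hi mem_filter mem_iota size_tuple => /andP[hs hil].
  have il : (i < len.+1)%N by lia.
  exists (Ordinal il, ~~ (mean_score r (take i b) < 1 / 2)).
  have sz : size (take i b) = i by rewrite size_takel // size_tuple; lia.
  have := stopped_dev R _ _ _ e01 hs; rewrite sz /F /=.
  congr (_ <= _.*2)%N; symmetry.
  rewrite (hits_sum _ _ _ _ _ (fun n => n)) //.
  apply: eq_bigr => n _; rewrite muln1 /score; congr (nat_of_bool (detect_1bit _ _ == _)).
  rewrite nth_take // (drop_nth false) //= ?take0 // size_tuple.
  by have := ltn_ord n; lia.
apply: le_trans (_ : \sum_(p : 'I_len.+1 * bool) tail_bound R e <= _); last first.
  by rewrite sumr_const card_prod card_ord card_bool mulr_natl.
apply: ler_sum => -[i m] _.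
rewrite (Pr_tuple R _ (F (i, m))) ler_pdivrMr ?exprn_gt0 // mulrC.
have hlen : len = (i * 1 + (len - i))%N by have := ltn_ord i; lia.
have hflip n x : size x = 0%N -> ~~ (score m n (false :: x) && score m n (true :: x)).
  by case: x => // _; rewrite /score /detect_1bit /=; case: (_ < _); case: m.
have := stop_dev_tail _ nat (fun n _ => n.+1) (score m) 1 i (len - i) 0%N e isT hflip e01.
rewrite -hlen; apply: le_trans; apply: bsum_le => w _; rewrite asboolb; exact: lexx.
Qed.

End Uniform.

Section Reduction.
Variable R : realType.

Lemma negl_Pr_embed (W : scheme R) (z : nat -> bits) (m : bool) (len : nat -> nat) :
  (forall lam, 0 < threshold W lam < 1) ->
  negl (threshold W) -> secure_prg R (key_len W) (prg W) ->
  (forall lam, 0 < block_len W lam)%N ->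
  poly_time (fun lam => [:: unary lam]) (fun lam => unary (block_len W lam)) ->
  poly_time_predictor (predictor W) -> poly_bounded len ->
  poly_time (fun lam => [:: unary lam]) z ->
  exists2 nu : nat -> R, negl nu & forall lam,
    Pr R (fun sk : (key_len W lam).-tuple bool =>
            exists b : bits,
              [/\ (size b < len lam)%N, embed W lam sk (z lam) m b
                & (detect W lam sk b).1 <> Some m]) < nu lam.
Proof.
move=> e01 hneg [_ _ hsec] k0 hblock [cp [dp hp]] hlen hz.
have [ck [dk hk]] := hblock; have [cz [dz hz']] := hz.
pose k := block_len W.
pose G lam n sk := deviates R W lam (z lam) m n (prg_prefix (prg W) sk (n * k lam)).
(* Advice: the round that most often deviates under the pseudorandom stream is
   given to the adversary by the length of its sample, and the threshold by the
   number of its coins; neither need be computable. *)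
have /choice[worst hworst] lam : exists w, (w <= len lam)%N /\
    forall i : 'I_(len lam).+1,
    Pr R (fun sk : (key_len W lam).-tuple bool => G lam i sk) <=
    Pr R (fun sk : (key_len W lam).-tuple bool => G lam w sk).
  pose F (i : 'I_(len lam).+1) :=
    Pr R (fun sk : (key_len W lam).-tuple bool => G lam i sk).
  exists [arg max_(i > ord0) F i]%O; case: arg_maxP => // i _ hi.
  by split=> [|j]; [rewrite -ltnS|apply: hi].
pose coins lam := stop_dev R (threshold W lam) (worst lam).
pose A := adversary_verdict k z m (below_prob R (predictor W) m).
have hA : poly_time_adversary A.
  apply: (adversary_verdict_poly_time ck cz cp dk dz dp k z m) => //.
  - by move=> n; have [t [s [h1 h2 h3]]] := hk n; exists t, s; split=> //;
      move: h3; rewrite /= size_nseq addn0.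
  - by move=> n; have [t [s [h1 h2 h3]]] := hz' n; exists t, s; split=> //;
      move: h3; rewrite /= size_nseq addn0.
  - move=> s r; have [t [s' [h1 h2 h3]]] := hp (s, m, r).
    by exists t, s'; split=> //; move: h3; rewrite /= addn0 -addnA.
have AE lam w u : size w = (worst lam * k lam)%N -> size u = coins lam ->
    A lam w u = deviates R W lam (z lam) m (worst lam) w.
  move=> hw hu; rewrite /A /adversary_verdict (nblocks_mul _ (worst lam)) // hu.
  by rewrite mul2n.
have hadv : negl (prg_advantage R (key_len W) (prg W)
    (fun lam => worst lam * k lam)%N coins A).
  apply: hsec => //.
    apply: (@poly_bounded_le _ (fun lam => len lam * size (unary (k lam)))%N).
      by move=> lam; rewrite /unary size_nseq leq_mul2r (hworst lam).1 orbT.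
    exact: poly_boundedM hlen (poly_bounded_size_poly_time _ hblock).
  apply: poly_bounded_le (poly_boundedS _ hlen) => lam.
  apply: leq_trans (stop_dev_le _ _ _) _; exact: (hworst lam).1.
set adv := prg_advantage _ _ _ _ _ _ in hadv.
pose q lam := tail_bound R (threshold W lam).
have hq : negl q by apply: negl_tail_bound => // lam; case/andP: (e01 lam) => /ltW.
exists (fun lam => (len lam).+1%:R * (adv lam + q lam) + q lam).
  apply: neglD => //; apply: (neglM_poly _ (fun lam => (len lam).+1)).
    exact: poly_boundedS.
  exact: neglD.
move=> lam; have [e0 _] := andP (e01 lam).
apply: le_lt_trans (_ : (len lam).+1%:R * (adv lam + q lam) < _); last first.
  by rewrite ltrDl tail_bound_gt0.
apply: le_trans (Pr_exists R _ 'I_(len lam).+1 _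
  (fun i (sk : (key_len W lam).-tuple bool) => G lam i sk) _) _.
  move=> sk [b [hb he hd]].
  have hb' : (size b < (len lam).+1)%N by lia.
  by exists (Ordinal hb'); apply: embed_wrong_deviates.
rewrite -[X in X%:R * _]card_ord mulr_natl -sumr_const; apply: ler_sum => i _.
apply: le_trans ((hworst lam).2 i) _.
have cg n : (0 < #|{: n.-tuple bool}|)%N by rewrite card_tuple expn_gt0 card_bool.
have h1 : Pr R (fun x : (key_len W lam).-tuple bool * (coins lam).-tuple bool =>
    A lam (prg_prefix (prg W) x.1 (worst lam * k lam)) x.2) =
    Pr R (fun sk : (key_len W lam).-tuple bool => G lam (worst lam) sk).
  rewrite -(Pr_fst R _ _ (fun sk : (key_len W lam).-tuple bool => G lam (worst lam) sk)
    (cg (coins lam))).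
  by congr (Pr R); apply/funext => x; rewrite AE // ?size_mkseq ?size_tuple.
have h2 : Pr R (fun x : (worst lam * k lam).-tuple bool * (coins lam).-tuple bool =>
    A lam x.1 x.2) <= q lam.
  apply: le_trans _ (Pr_deviates R W lam (z lam) m (worst lam) (e01 lam) (k0 lam)).
  rewrite -(Pr_fst R _ _ (fun w : (worst lam * k lam).-tuple bool =>
    deviates R W lam (z lam) m (worst lam) w) (cg (coins lam))).
  by apply: Pr_le => x; rewrite AE // size_tuple.
rewrite -h1 /adv /prg_advantage.
set p1 := Pr R _ in h1 *; set p2 := Pr R _ in h2 *.
have := ler_norm (p1 - p2); lra.
Qed.
End Reduction.

Theorem claim2 (R : realType) (W : scheme R)
  (heta01 : forall lam : nat, 0 < threshold W lam < 1)
  (heta : negl (threshold W))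
  (hprg : secure_prg R (key_len W) (prg W))
  (hblock0 : forall lam : nat, (0 < block_len W lam)%N)
  (hblock : poly_time (fun lam : nat => [:: unary lam])
                      (fun lam : nat => unary (block_len W lam)))
  (hpred : poly_time_predictor (predictor W))
  (hentropy : ~ (forall z : bits, entropy (predictor W z) = 0))
  (len : nat -> nat) (hlen : poly_bounded len) :
  (forall (z : nat -> bits) (m : bool),
     poly_time (fun lam : nat => [:: unary lam]) z ->
     exists2 nu : nat -> R, negl nu & forall lam : nat,
       Pr R (fun sk : (key_len W lam).-tuple bool =>
               exists b : bits,
                 [/\ (size b < len lam)%N,
                     embed W lam sk (z lam) m b
                   & (detect W lam sk b).1 <> Some m]) < nu lam)
  /\
  (exists2 nu : nat -> R, negl nu & forall lam : nat,
     Pr R (fun x : (key_len W lam).-tuple bool * (len lam).-tuple bool =>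
             (detect W lam x.1 x.2).1 <> None) < nu lam).
Proof.
split=> [z m hz|]; first exact: negl_Pr_embed.
pose q lam := tail_bound R (threshold W lam).
have q0 lam : 0 < q lam by apply: tail_bound_gt0; case/andP: (heta01 lam).
exists (fun lam => ((len lam).+1 * 2).+1%:R * q lam).
  apply: (neglM_poly _ (fun lam => ((len lam).+1 * 2).+1)).
    apply: poly_boundedS; apply: poly_boundedM (poly_bounded_const 2).
    exact: poly_boundedS.
  by apply: negl_tail_bound => // lam; case/andP: (heta01 lam) => /ltW.
move=> lam; apply: le_lt_trans (_ : ((len lam).+1 * 2)%:R * q lam < _); last first.
  by rewrite ltr_pM2r // ltr_nat.
apply: Pr_prod_le => [|sk]; first by rewrite mulr_ge0 // ltW.
exact: Pr_detect_uniform.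
Qed.
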